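(* Let $X$ be a normed space over $\mathbb{K}$ and let $(x_n)_{n=1}^{\infty}$ be a sequence of nonzero vectors in $X$. Then the following conditions are equivalent: (i) $(x_n)_{n=1}^{\infty}$ is an essential Schauder basis for $\widehat{[x_n : n\in\mathbb{N}]} \subseteq \widehat{X}$; (ii) $(x_n)_{n=1}^{\infty}$ is an essential basic sequence in $X$; (iii) there exists $M \geq 1$ such that for every sequence of scalars $(a_n)_{n=1}^{\infty}$, $$\left\Vert \sum_{i=1}^{m} a_i x_i \right\Vert \leq M \left\Vert \sum_{i=1}^{n} a_i x_i \right\Vert \quad \text{whenever } n \geq m.$$
   Context: Normed spaces are over the scalar field $\mathbb{K}$ (real or complex) and are not assumed complete. For a normed space $S$, $\widehat{S}$ denotes its completion, with $S$ dense in $\widehat{S}$. $[x_n : n\in\mathbb{N}]$ is the linear span and $\overline{[x_n:n\in\mathbb{N}]}$ is its closure in $X$; $\widehat{[x_n:n\in\mathbb{N}]}$ is the completion of the span, viewed inside $\widehat X$ (i.e. the closure of the span in $\widehat X$). A sequence $(x_n)$ in a normed space $Z$ is a Schauder basis for $Z$ if for each $x\in Z$ there is a unique sequence of scalars $(a_n)$ with $x=\sum_{n=1}^\infty a_n x_n$ (norm convergence in $Z$). Given a Schauder basis $(x_n)$ of $Z$, let $\mathcal{L}_Z=\{(a_n)_{n=1}^\infty : \sum_{n=1}^\infty a_n x_n \text{ converges in } Z\}$ with the norm $\eta((a_n))=\sup_{n}\Vert\sum_{i=1}^n a_i x_i\Vert$. The Schauder basis $(x_n)$ is an essential Schauder basis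 for $Z$ if $T_Z:\mathcal{L}_Z\to Z$, $T_Z((a_n))=\sum_{n=1}^\infty a_n x_n$, is an isomorphism of normed spaces (a linear bijection that is bounded with bounded inverse). A sequence $(x_n)$ in $X$ is an essential basic sequence in $X$ if it is an essential Schauder basis for $\overline{[x_n:n\in\mathbb{N}]}$ (closure in $X$). *)

(* Defs.v *)
From HB Require Import structures.
From mathcomp Require Import all_boot all_order all_algebra.
From mathcomp Require Import complex.
From mathcomp Require Import boolp classical_sets functions reals topology normedtype.
From mathcomp Require Import sequences ring.

Set Implicit Arguments.
Unset Strict Implicit.
Unset Printing Implicit Defensive.

Import Order.TTheory GRing.Theory Num.Theory.
Import numFieldNormedType.Exports.

Local Open Scope classical_set_scope.
Local Open Scope ring_scope.

(* The scalar field is the field R of real numbers or the field R[i] of complex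
   numbers. Norms take their values in the scalar field itself; on R[i],
   u <= v means that v - u is a nonnegative real, so norms are nonnegative
   reals and a bound 1 <= M forces M to be real. *)
Variant scalar_kind := RealScalars | ComplexScalars.

Definition scalar_field (R : realType) (k : scalar_kind) : numFieldType :=
  match k with RealScalars => R | ComplexScalars => R[i] end.

(* Sequences (x_n), n >= 1, are indexed from 0. A subspace Z of a normed space V
   is a set Z : set V carrying the norm of V: a series converges in Z when it
   converges in V to a point of Z. *)
Section Definitions.
Context {K : numFieldType}.

Definition linear_span (V : lmodType K) (x : nat -> V) : set V :=
  [set v | exists n (a : nat -> K), v = \sum_(i < n) a i *: x i].

(* T restricts to an isomorphism of normed spaces from the subspace A of U,
   normed by nA, onto the subspace B of V, normed by nB; the last clause is the
   boundedness of the inverse. *)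
Definition normed_isomorphism (U V : lmodType K)
    (A : set U) (nA : U -> K) (B : set V) (nB : V -> K) (T : U -> V) : Prop :=
  [/\ forall (c : K) u v, A u -> A v -> T (c *: u + v) = c *: T u + T v,
      set_bij A B T,
      exists2 C : K, 0 <= C & forall u, A u -> nB (T u) <= C * nA u
    & exists2 C : K, 0 <= C & forall u, A u -> nA u <= C * nB (T u)].

Section Schauder.
Context {V : normedModType K}.
Implicit Types (Z : set V) (x : nat -> V) (a : nat -> K).

Definition schauder_basis Z x : Prop :=
  (forall n, Z (x n)) /\
  forall z, Z z -> exists! a, [series a n *: x n]_n @ \oo --> z.

Definition coef_space Z x : set (nat -> K) :=
  [set a | exists2 z, Z z & [series a n *: x n]_n @ \oo --> z].

(* On coef_space Z x the partial sums are bounded, so the supremum is the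
   genuine least upper bound; elsewhere its value is irrelevant. *)
Definition coef_norm x a : K :=
  supremum 0 [set `|\sum_(i < n.+1) a i *: x i| | n in [set: nat]].

Definition sum_map x a : V := limn [series a n *: x n]_n.

Definition essential_schauder_basis Z x : Prop :=
  schauder_basis Z x /\
  normed_isomorphism (coef_space Z x) (coef_norm x) Z Num.norm (sum_map x).

Definition essential_basic_sequence x : Prop :=
  essential_schauder_basis (closure (linear_span x)) x.
End Schauder.

Definition is_completion (X : normedModType K) (Xh : completeNormedModType K)
    (iota : {linear X -> Xh}) : Prop :=
  (forall v, `|iota v| = `|v|) /\ dense (range iota).
End Definitions.

(* The rest of the file constructs a completion of any normed space, as the
   space of Cauchy sequences modulo null sequences. *)
Section Sequences.
Context {K : numFieldType} {V : normedModType K}.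
Implicit Types u v w : nat -> V.

Definition null u := forall e : K, 0 < e ->
  exists N, forall n, (N <= n)%N -> `|u n| < e.
Definition cauchy_seq u := forall e : K, 0 < e ->
  exists N, forall m n, (N <= m)%N -> (N <= n)%N -> `|u m - u n| < e.

Lemma null0 : null (fun=> 0).
Proof. by move=> e e0; exists 0%N => n _; rewrite normr0. Qed.

Lemma nullD u v : null u -> null v -> null (u \+ v).
Proof.
move=> hu hv e e0; have e2 : 0 < e / 2 by rewrite divr_gt0.
have [N1 h1] := hu _ e2; have [N2 h2] := hv _ e2.
exists (maxn N1 N2) => n; rewrite geq_max => /andP[l1 l2] /=.
by rewrite (le_lt_trans (ler_normD _ _))// (splitr e) ltrD// (h1, h2).
Qed.

Lemma nullZ (c : K) u : null u -> null (fun n => c *: u n).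
Proof.
move=> hu e e0; have c0 : 0 < `|c| + 1 by rewrite ltr_wpDl.
have [N h] := hu _ (divr_gt0 e0 c0); exists N => n /h.
rewrite ltr_pdivlMr// mulrC normrZ; apply: le_lt_trans.
by rewrite ler_wpM2r// lerDl.
Qed.

Lemma eq_null u v : u =1 v -> null u -> null v.
Proof. by move=> uv hu e /hu[N h]; exists N => n /h; rewrite uv. Qed.

Lemma null_cauchy u v : null (u \- v) -> cauchy_seq v -> cauchy_seq u.
Proof.
move=> huv hv e e0; have e3 : 0 < e / 3 by rewrite divr_gt0.
have [N1 h1] := huv _ e3; have [N2 h2] := hv _ e3.
exists (maxn N1 N2) => m n; rewrite !geq_max => /andP[l1 l2] /andP[l3 l4].
have -> : u m - u n = (u m - v m) + (v m - v n) + (v n - u n).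
  by rewrite [u m - v m + _]addrA subrK addrA subrK.
have -> : e = e / 3 + e / 3 + e / 3 by field.
rewrite (le_lt_trans (ler_normD _ _))// ltrD//; last by rewrite distrC; exact: h1.
by rewrite (le_lt_trans (ler_normD _ _))// ltrD//; [exact: h1|exact: h2].
Qed.

Lemma cauchyD u v : cauchy_seq u -> cauchy_seq v -> cauchy_seq (u \+ v).
Proof.
move=> hu hv e e0; have e2 : 0 < e / 2 by rewrite divr_gt0.
have [N1 h1] := hu _ e2; have [N2 h2] := hv _ e2.
exists (maxn N1 N2) => m n; rewrite !geq_max => /andP[l1 l2] /andP[l3 l4] /=.
by rewrite opprD addrACA (le_lt_trans (ler_normD _ _))// (splitr e) ltrD// (h1, h2).
Qed.

Lemma cauchyZ (c : K) u : cauchy_seq u -> cauchy_seq (fun n => c *: u n).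
Proof.
move=> hu e e0; have c0 : 0 < `|c| + 1 by rewrite ltr_wpDl.
have [N h] := hu _ (divr_gt0 e0 c0); exists N => m n lm ln.
have := h _ _ lm ln; rewrite ltr_pdivlMr// mulrC -scalerBr normrZ.
by apply: le_lt_trans; rewrite ler_wpM2r// lerDl.
Qed.

Lemma cauchy_cst (c : V) : cauchy_seq (fun=> c).
Proof. by move=> e e0; exists 0%N => *; rewrite subrr normr0. Qed.
End Sequences.

Section ScalarCompleteness.
Context (R : realType) (k : scalar_kind).
Local Notation K := (scalar_field R k).

Lemma scalar_archimedean (e : K) : 0 < e -> exists n, n.+1%:R^-1 < e.
Proof.
have aR (r : R) : 0 < r -> exists n, n.+1%:R^-1 < r.
  move=> r0; have /archi_boundP : 0 <= r^-1 by rewrite invr_ge0 ltW.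
  case: (Num.bound _) => [|n] h; first by move: h; rewrite ltNge invr_ge0 ltW.
  by exists n; rewrite invf_plt// ?posrE.
case: k e => /= e; first exact: aR.
rewrite ltcE/= => /andP[/eqP Ime /aR[n hn]]; exists n.
have -> : n.+1%:R^-1 = (n.+1%:R^-1)%:C%C :> R[i].
  by rewrite fmorphV rmorph_nat.
by rewrite ltcE /= hn Ime eqxx.
Qed.

Lemma scalar_cauchy (r : nat -> K) :
  (forall n, 0 <= r n) -> cauchy_seq (r : nat -> (K : normedModType K)) ->
  exists l : K, null (fun n => r n - l : (K : normedModType K)).
Proof.
have cR (s : nat -> R) : (forall e, 0 < e -> exists N, forall m n,
    (N <= m)%N -> (N <= n)%N -> `|s m - s n| < e) ->
    exists l, forall e, 0 < e -> exists N, forall n, (N <= n)%N -> `|s n - l| < e.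
  move=> hs; have /cvg_ex[l /cvgrPdist_lt hl] : cvgn s.
    apply: cauchy_cvg; apply: cauchy_exP => e e0; have [N hN] := hs e e0.
    exists (s N); exists N => // n /= Nn; rewrite -ball_normE /=.
    exact: hN.
  exists l => e /hl [N _ hN]; exists N => n /hN; by rewrite distrC.
have nC (x : R) : `|x%:C%C| = `|x|%:C%C :> R[i].
  by rewrite normc_def /= expr0n addr0 sqrtr_sqr.
case: k r => /= r r0 hr; first exact: cR.
have rE n : r n = (complex.Re (r n))%:C%C.
  by have := r0 n; rewrite lecE /=; case: (r n) => x y /= /andP[/eqP ->].
have [|l hl] := cR (fun n => complex.Re (r n)).
  move=> e e0; have [|N hN] := hr (e%:C%C); first by rewrite ltcR.
  exists N => m n lm ln; have := hN m n lm ln.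
  by rewrite rE (rE n) -rmorphB nC ltcR.
exists l%:C%C => e; rewrite ltcE /= => /andP[/eqP Ime /hl[N hN]].
exists N => n /hN h; rewrite rE -rmorphB nC ltcE /= h.
by rewrite Ime eqxx.
Qed.
End ScalarCompleteness.

Section Completion.
Context (R : realType) (k : scalar_kind).
Local Notation K := (scalar_field R k).
Context (X : normedModType K).

Definition cauchy_class (u : nat -> X) : set (nat -> X) :=
  [set v | cauchy_seq v /\ null (u \- v)].
Definition cauchy_repr (u : nat -> X) : nat -> X := get (cauchy_class u).

(* Each class is represented by its member selected by cauchy_repr. *)
Definition completion :=
  {u : nat -> X | `[< cauchy_seq u /\ cauchy_repr u = u >]}.
HB.instance Definition _ := Choice.on completion.

Lemma cauchy_reprP u : cauchy_seq u ->
  cauchy_seq (cauchy_repr u) /\ null (u \- cauchy_repr u).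
Proof.
move=> hu; apply: (@getPex _ (cauchy_class u)); exists u; split => //.
by apply: eq_null (null0 (V := X)) => n /=; rewrite subrr.
Qed.

Lemma null_trans (u v w : nat -> X) :
  null (u \- v) -> null (v \- w) -> null (u \- w).
Proof. by move=> /nullD h /h; apply: eq_null => n /=; rewrite addrA subrK. Qed.

Lemma null_sym (u v : nat -> X) : null (u \- v) -> null (v \- u).
Proof. by move=> h e /h[N hN]; exists N => n /hN /=; rewrite distrC. Qed.

Lemma cauchy_repr_eq u v : null (u \- v) -> cauchy_repr u = cauchy_repr v.
Proof.
move=> huv; congr (get _); apply/seteqP; split=> w [hw h]; split => //.
  exact: null_trans (null_sym huv) h.
exact: null_trans huv h.
Qed.

Lemma class_of_subproof (u : nat -> X) (hu : cauchy_seq u) :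
  `[< cauchy_seq (cauchy_repr u) /\ cauchy_repr (cauchy_repr u) = cauchy_repr u >].
Proof.
have [h1 h2] := cauchy_reprP hu; apply/asboolP; split => //.
exact/esym/cauchy_repr_eq.
Qed.

Definition class_of (u : nat -> X) (hu : cauchy_seq u) : completion :=
  exist _ (cauchy_repr u) (class_of_subproof hu).

Lemma completion_cauchy (p : completion) : cauchy_seq (val p).
Proof. by have /asboolP[] := valP p. Qed.

Lemma class_ofK (p : completion) (hp : cauchy_seq (val p)) : class_of hp = p.
Proof. by apply: val_inj => /=; have /asboolP[] := valP p. Qed.

Lemma class_of_eq u v (hu : cauchy_seq u) (hv : cauchy_seq v) :
  null (u \- v) -> class_of hu = class_of hv.
Proof. by move=> h; apply: val_inj => /=; exact: cauchy_repr_eq. Qed.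

Lemma class_of_ext u v (hu : cauchy_seq u) (hv : cauchy_seq v) :
  u =1 v -> class_of hu = class_of hv.
Proof. by move=> /funext uv; subst v; congr class_of; exact: Prop_irrelevance. Qed.

Lemma completionP (p : completion) : exists u (hu : cauchy_seq u), p = class_of hu.
Proof. by exists (val p), (completion_cauchy p); rewrite class_ofK. Qed.

Definition cadd p q : completion :=
  class_of (cauchyD (completion_cauchy p) (completion_cauchy q)).
Definition cscale (c : K) p : completion :=
  class_of (cauchyZ c (completion_cauchy p)).
Definition czero : completion := class_of (cauchy_cst (0 : X)).

Lemma caddE u v (hu : cauchy_seq u) (hv : cauchy_seq v) :
  cadd (class_of hu) (class_of hv) = class_of (cauchyD hu hv).
Proof.
apply: class_of_eq => /=.
apply: eq_null (nullD (null_sym (cauchy_reprP hu).2) (null_sym (cauchy_reprP hv).2)).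
by move=> n /=; rewrite opprD addrACA.
Qed.

Lemma cscaleE c u (hu : cauchy_seq u) :
  cscale c (class_of hu) = class_of (cauchyZ c hu).
Proof.
apply: class_of_eq => /=; apply: eq_null (nullZ c (null_sym (cauchy_reprP hu).2)).
by move=> n /=; rewrite scalerBr.
Qed.

Lemma caddA : associative cadd.
Proof.
move=> p q r; have [u [hu ->]] := completionP p; have [v [hv ->]] := completionP q.
have [w [hw ->]] := completionP r; rewrite !caddE.
by apply: class_of_ext => n /=; rewrite addrA.
Qed.

Lemma caddC : commutative cadd.
Proof.
move=> p q; have [u [hu ->]] := completionP p; have [v [hv ->]] := completionP q.
by rewrite !caddE; apply: class_of_ext => n /=; rewrite addrC.
Qed.

Lemma cadd0 : left_id czero cadd.
Proof.
move=> p; have [u [hu ->]] := completionP p.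
by rewrite !caddE; apply: class_of_ext => n /=; rewrite add0r.
Qed.

Lemma caddN : left_inverse czero (cscale (-1)) cadd.
Proof.
move=> p; have [u [hu ->]] := completionP p.
rewrite cscaleE caddE; apply: class_of_ext => n /=.
by rewrite scaleN1r addNr.
Qed.

HB.instance Definition _ :=
  GRing.isZmodule.Build completion caddA caddC cadd0 caddN.

Lemma cscaleA a b p : cscale a (cscale b p) = cscale (a * b) p.
Proof.
have [u [hu ->]] := completionP p.
by rewrite !cscaleE; apply: class_of_ext => n /=; rewrite scalerA.
Qed.

Lemma cscale1 : left_id 1 cscale.
Proof.
move=> p; have [u [hu ->]] := completionP p.
by rewrite !cscaleE; apply: class_of_ext => n /=; rewrite scale1r.
Qed.

Lemma cscaleDr : right_distributive cscale +%R.
Proof.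
move=> c p q; have [u [hu ->]] := completionP p; have [v [hv ->]] := completionP q.
rewrite /GRing.add /= !(caddE, cscaleE).
by apply: class_of_ext => n /=; rewrite scalerDr.
Qed.

Lemma cscaleDl p : {morph cscale^~ p : a b / a + b}.
Proof.
move=> a b; have [u [hu ->]] := completionP p.
rewrite [in RHS]/GRing.add /= !(caddE, cscaleE).
by apply: class_of_ext => n /=; rewrite scalerDl.
Qed.

HB.instance Definition _ :=
  GRing.Zmodule_isLmodule.Build K completion cscaleA cscale1 cscaleDr cscaleDl.

Definition norm_limit (u : nat -> X) (l : K) :=
  null (fun n => `|u n| - l : (K : normedModType K)).

Lemma norm_limit_ex u : cauchy_seq u -> exists l, norm_limit u l.
Proof.
move=> hu; apply: scalar_cauchy => // e e0.
have [N hN] := hu e e0; exists N => m n lm ln.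
by apply: le_lt_trans (hN m n lm ln); exact: ler_dist_dist.
Qed.

Lemma null_cst_eq0 (c : K) : null (fun=> c : (K : normedModType K)) -> c = 0.
Proof.
move=> h; apply/eqP; apply: contraT => c0.
have /h[N /(_ N (leqnn N))] : 0 < `|c| by rewrite normr_gt0.
by rewrite ltxx.
Qed.

Lemma null_lim_ge0 (r : nat -> K) (l : K) : (forall n, 0 <= r n) ->
  null (fun n => r n - l : (K : normedModType K)) -> 0 <= l.
Proof.
move=> r0 h; suff -> : l = `|l| by [].
apply/eqP; rewrite -subr_eq0; apply/eqP/null_cst_eq0.
have h' : null (fun n => r n - `|l| : (K : normedModType K)).
  move=> e /h[N hN]; exists N => n /hN; apply: le_lt_trans.
  by rewrite -{1}(ger0_norm (r0 n)); exact: ler_dist_dist.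
apply: eq_null (nullD h' (nullZ (-1) h)) => n /=.
by rewrite scaleN1r /=; ring.
Qed.

Lemma norm_limit_uniq u l l' : norm_limit u l -> norm_limit u l' -> l = l'.
Proof.
move=> h h'; apply/eqP; rewrite -subr_eq0; apply/eqP/null_cst_eq0.
apply: eq_null (nullD h' (nullZ (-1) h)) => n /=.
by rewrite scaleN1r /=; ring.
Qed.

Lemma norm_limit_null u v l : null (u \- v) -> norm_limit u l -> norm_limit v l.
Proof.
move=> huv hu e e0; have e2 : 0 < e / 2 by rewrite divr_gt0.
have [N1 h1] := huv _ e2; have [N2 h2] := hu _ e2.
exists (maxn N1 N2) => n; rewrite geq_max => /andP[/h1 l1 /h2 l2].
have -> : `|v n| - l = (`|v n| - `|u n|) + (`|u n| - l) by rewrite addrA subrK.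
rewrite (le_lt_trans (ler_normD _ _))// (splitr e) ltrD//.
by apply: le_lt_trans l1; rewrite distrC; exact: ler_dist_dist.
Qed.

Definition cnorm (p : completion) : K := xget 0 [set l | norm_limit (val p) l].

Lemma cnormP u (hu : cauchy_seq u) : norm_limit u (cnorm (class_of hu)).
Proof.
have [l hl] := norm_limit_ex (completion_cauchy (class_of hu)).
apply: norm_limit_null (null_sym (cauchy_reprP hu).2) _.
exact: (@xgetI _ 0 [set l | norm_limit (val (class_of hu)) l] l hl).
Qed.

Lemma cnormE u (hu : cauchy_seq u) l : norm_limit u l -> cnorm (class_of hu) = l.
Proof. exact: norm_limit_uniq (cnormP hu). Qed.

Lemma cnorm_ge0 p : 0 <= cnorm p.
Proof.
have [u [hu ->]] := completionP p.
by apply: (null_lim_ge0 _ (cnormP hu)) => n.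
Qed.

Lemma cnormD p q : cnorm (p + q) <= cnorm p + cnorm q.
Proof.
have [u [hu ->]] := completionP p; have [v [hv ->]] := completionP q.
rewrite [class_of hu + _]caddE -subr_ge0.
apply: (@null_lim_ge0 (fun n => `|u n| + `|v n| - `|u n + v n|)).
  by move=> n; rewrite subr_ge0 ler_normD.
apply: eq_null (nullD (nullD (cnormP hu) (cnormP hv))
  (nullZ (-1) (cnormP (cauchyD hu hv)))) => n /=.
rewrite scaleN1r; by ring.
Qed.

Lemma cnormZ (c : K) p : cnorm (c *: p) = `|c| * cnorm p.
Proof.
have [u [hu ->]] := completionP p; rewrite [c *: _]cscaleE.
apply: cnormE; apply: eq_null (nullZ `|c| (cnormP hu)) => n /=.
by rewrite scalerBr normrZ.
Qed.

Lemma cnorm_eq0 p : cnorm p = 0 -> p = 0.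
Proof.
have [u [hu ->]] := completionP p => h; have := cnormP hu; rewrite h => h'.
apply: class_of_eq => e /h'[N hN]; exists N => n /hN.
by rewrite /= !subr0 normr_id.
Qed.

HB.instance Definition _ :=
  Lmodule_isNormed.Build K completion cnormD cnormZ cnorm_eq0.

Definition to_completion (x : X) : completion := class_of (cauchy_cst x).

Lemma to_completion_linear : linear to_completion.
Proof.
by move=> c x y; rewrite -[RHS]/(cadd (cscale c _) _) cscaleE caddE; exact: class_of_ext.
Qed.
HB.instance Definition _ :=
  GRing.isLinear.Build K X completion *:%R to_completion to_completion_linear.

Lemma to_completion_norm x : `|to_completion x| = `|x|.
Proof.
apply: cnormE => e e0; exists 0%N => n _.
by rewrite subrr normr0.
Qed.

Lemma to_completion_near u (hu : cauchy_seq u) (e : K) : 0 < e ->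
  exists N, forall n, (N <= n)%N -> `|class_of hu - to_completion (u n)| < e.
Proof.
move=> e0; have e2 : 0 < e / 2 by rewrite divr_gt0.
have [N hN] := hu _ e2; exists N => n Nn.
rewrite -[- _]scaleN1r [_ *: _]cscaleE [class_of hu + _]caddE.
set hw := cauchyD _ _.
apply: (@le_lt_trans _ _ (e / 2)); last first.
  by rewrite [ltRHS]splitr ltrDl.
rewrite -subr_ge0.
apply: (@null_lim_ge0 (fun m => e / 2 - `|u (maxn N m) - u n|)).
  by move=> m; rewrite subr_ge0 ltW// hN// leq_maxl.
move=> d d0; have [M hM] := cnormP hw d0.
exists (maxn M N) => m; rewrite geq_max => /andP[/hM h /maxn_idPr ->].
move: h; set L := cnorm _ => /= h.
have -> : e / 2 - `|u m - u n| - (e / 2 - L) = - (`|u m + -1 *: u n| - L).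
  by rewrite scaleN1r; ring.
by rewrite normrN.
Qed.

Lemma to_completion_dense : dense (range to_completion).
Proof.
move=> O [p Op] /(_ p) /(_ Op) /nbhs_normP[e /= e0 he].
have [u [hu pE]] := completionP p.
have [N /(_ N (leqnn N)) hN] := to_completion_near hu e0.
exists (to_completion (u N)); split; last by exists (u N).
by apply: he; rewrite /= pE.
Qed.

Lemma completion_complete (F : set_system completion) :
  ProperFilter F -> cauchy F -> cvg F.
Proof.
move=> FF /cauchyP hF.
pose d n : K := n.+1%:R^-1.
have d0 n : 0 < d n by rewrite invr_gt0.
have dle N n : (N <= n)%N -> d n <= d N.
  by move=> Nn; rewrite lef_pV2 ?posrE// ler_nat.
have /choice[y hy] n : exists y, F (ball (to_completion y) (d n + d n)).
  have [x hx] := hF _ (d0 n).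
  have [w [xw [y _ yw]]] := to_completion_dense
    (ex_intro _ x (ballxx x (d0 n)) : ball x (d n) !=set0) (ball_open x (d n)).
  exists y; apply: filterS hx => z; apply: ball_triangle.
  by rewrite yw; exact: ball_sym.
have small (e : K) : 0 < e -> exists N, forall n, (N <= n)%N -> d n + d n < e.
  move=> e0; have [|N hN] := @scalar_archimedean R k (e / 2); first by rewrite divr_gt0.
  exists N => n /dle Nn; rewrite (splitr e).
  by rewrite ltrD// (le_lt_trans Nn).
have yC : cauchy_seq y.
  move=> e e0; have [|N hN] := small (e / 2); first by rewrite divr_gt0.
  exists N => m n /hN lm /hN ln.
  have [z [zm zn]] := filter_ex (filterI (hy m) (hy n)).
  rewrite -to_completion_norm linearB /=.
  have := ball_triangle zm (ball_sym zn); rewrite -ball_normE /= => h.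
  by rewrite (lt_trans h)// (splitr e) ltrD.
apply/cvg_ex; exists (class_of yC); apply/cvg_ballP => e e0.
have e2 : 0 < e / 2 by rewrite divr_gt0.
have [N1 h1] := small _ e2; have [N2 h2] := to_completion_near yC e2.
set n := maxn N1 N2; apply: filterS (hy n) => z hz.
rewrite (splitr e); apply: (@ball_triangle _ _ (to_completion (y n))).
  by rewrite -ball_normE /=; apply: h2; rewrite leq_maxr.
by apply: le_ball hz; apply/ltW/h1; rewrite leq_maxl.
Qed.
HB.instance Definition _ := Uniform_isComplete.Build completion completion_complete.

Lemma completion_is_completion :
  is_completion (to_completion : {linear X -> completion}).
Proof. by split; [exact: to_completion_norm|exact: to_completion_dense]. Qed.
End Completion.

Lemma completion_exists (R : realType) (k : scalar_kind)
    (X : normedModType (scalar_field R k)) :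
  exists (Xh : completeNormedModType (scalar_field R k))
    (iota : {linear X -> Xh}), is_completion iota.
Proof.
exists (completion X), (@to_completion R k X).
exact: completion_is_completion.
Qed.

(* Main.v *)
Require Import Defs.
From mathcomp Require Import all_boot all_order all_algebra.
From mathcomp Require Import boolp classical_sets functions reals topology normedtype.
From mathcomp Require Import sequences.
From mathcomp Require complex.

(** In every normed space V over the real or complex numbers, complete or not, a
    sequence of nonzero vectors is an essential basic sequence exactly when its
    partial sums satisfy the inequality of the third condition
    ([essential_basic_sequenceP]). That inequality involves only norms of finite
    linear combinations, so it holds in X exactly when it holds in the
    completion. Applying the characterization in X and in the completion gives
    the equivalence of the three conditions.

    X and its completion can be treated alike because all the limits that have
    to be constructed are limits of scalars. Let z be in the
    closure of the span and let y_j be finite combinations converging to z. The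
    inequality bounds each coefficient of y_j - y_l by a multiple of its norm,
    so the i-th coefficients of the y_j form a Cauchy sequence of scalars, with
    a limit a_i. It also bounds every partial sum of y_j - y_l by
    M |y_j - y_l|; letting l grow shows that the m-th partial sum of the series
    of the a_i x_i stays close to that of y_j, uniformly in m. For m large the
    latter is y_j itself, which is close to z: the series converges to z
    ([expansion_exists]).

    The rest compares definitions: the sum map is always a linear bijection of
    norm at most 1 for a Schauder basis, and boundedness of its inverse says
    that the partial sums of an expansion of z are at most C |z|
    ([essential_schauder_basisP]). Applied to a truncated sequence this is the
    inequality; conversely the inequality yields it by letting n go to
    infinity. *)

Set Implicit Arguments.
Unset Strict Implicit.
Unset Printing Implicit Defensive.

Import Order.TTheory GRing.Theory Num.Theory.
Import numFieldNormedType.Exports.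

Local Open Scope classical_set_scope.
Local Open Scope ring_scope.

(** * Completeness of the scalars *)

Section ScalarField.
Import complex.
Local Open Scope complex_scope.
Context (R : realType) (k : scalar_kind).
Local Notation K := (scalar_field R k).

Lemma scalar_complete (u : nat -> K) :
  cauchy_seq (u : nat -> (K : normedModType K)) ->
  exists l : K, null (fun n => u n - l : (K : normedModType K)).
Proof.
have complete_real (s : nat -> R) : (forall e, 0 < e -> exists N, forall m n,
    (N <= m)%N -> (N <= n)%N -> `|s m - s n| < e) ->
    exists l, forall e, 0 < e -> exists N, forall n, (N <= n)%N -> `|s n - l| < e.
  move=> hs; have /cvg_ex[l /cvgrPdist_lt hl] : cvgn s.
    apply: cauchy_cvg; apply: cauchy_exP => e e0; have [N hN] := hs e e0.
    exists (s N); exists N => // n /= Nn; rewrite -ball_normE /=.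
    exact: hN.
  by exists l => e /hl [N _ hN]; exists N => n /hN; rewrite distrC.
case: k u => /= u hu; first exact: complete_real.
(* It suffices to treat the real and imaginary parts separately. *)
have part_cauchy (f : {additive R[i] -> R}) : (forall z, `|f z|%:C <= `|z|) ->
    exists l, forall e, 0 < e ->
      exists N, forall n, (N <= n)%N -> `|f (u n) - l| < e.
  move=> f_le; apply: complete_real => e e0; have [|N hN] := hu e%:C.
    by rewrite ltcR.
  exists N => m n Nm Nn; rewrite -ltcR -raddfB.
  exact: le_lt_trans (f_le _) (hN m n Nm Nn).
have [a ha] := part_cauchy (@complex.Re R) (@normc_ge_Re R).
have [|b hb] := part_cauchy (@complex.Im R).
  move=> z; rewrite normc_def lecR -sqrtr_sqr ler_wsqrtr//.
  by rewrite lerDr sqr_ge0.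
exists (a +i* b) => e; rewrite ltcE /= => /andP[/eqP Ime Ree].
have e2 : 0 < complex.Re e / 2 by rewrite divr_gt0.
have [N1 h1] := ha _ e2; have [N2 h2] := hb _ e2.
exists (maxn N1 N2) => n; rewrite geq_max => /andP[/h1 Na /h2 Nb].
have -> : e = (complex.Re e)%:C by case: e Ime {Ree e2 h1 h2 Na Nb} => x y /= ->.
rewrite [X in `|X|]complexE (le_lt_trans (ler_normD _ _))//.
have normi : `|'i| = 1 :> R[i] by rewrite normc_def /= expr0n expr1n add0r sqrtr1.
rewrite normrM normi mul1r.
have nC (r : R) : `|r%:C| = `|r|%:C by rewrite normc_def /= expr0n addr0 sqrtr_sqr.
rewrite !nC -rmorphD ltcR (splitr (complex.Re e)).
by move: Na Nb; case: (u n) => x y /= Na Nb; rewrite ltrD.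
Qed.

(** The order of the complex numbers is partial, but a complex number above a
    real one is itself real, so the supremum can be taken in the reals. *)
Lemma scalar_supremum (E : set K) (B : K) :
  E !=set0 -> (forall r, E r -> 0 <= r) -> ubound E B -> supremums E !=set0.
Proof.
have sup_real (F : set R) (b : R) : F !=set0 -> ubound F b -> supremums F (sup F).
  move=> F0 hb; split; last by move=> c; exact: ge_sup.
  by apply: sup_upper_bound; split=> //; exists b.
case: k E B => /= E B; first by move=> E0 _ hB; exists (sup E); exact: sup_real hB.
move=> [r0 Er0] E_ge0 hB.
have ReE r : E r -> r = (complex.Re r)%:C.
  by move=> /E_ge0; rewrite lecE; case: r => x y /= /andP[/eqP ->].
have [||ub lub] := sup_real [set complex.Re r | r in E] (complex.Re B).
- by exists (complex.Re r0), r0.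
- by move=> _ [r Er <-]; have := hB r Er; rewrite lecE => /andP[].
exists (sup [set complex.Re r | r in E])%:C; split.
  by move=> r Er; rewrite (ReE r Er) lecR; apply: ub; exists r.
move=> c hc; rewrite lecE /=; apply/andP; split.
  by have := hc _ Er0; rewrite (ReE _ Er0) lecE /= => /andP[].
by apply: lub => _ [r Er <-]; have := hc _ Er; rewrite lecE => /andP[].
Qed.
End ScalarField.

(** * Partial sums and the basis inequality *)

Section PartialSums.
Context {K : numFieldType} {V : normedModType K}.
Implicit Types (x : nat -> V) (a b : nat -> K) (z : V).

Definition partial_sum x a (n : nat) : V := \sum_(i < n) a i *: x i.

(** Allowing empty partial sums, indexed by 0, lets it match the indexing of
    series and does not strengthen it: see [basis_inequalityS]. *)
Definition basis_inequality x (M : K) := forall a m n, (m <= n)%N ->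
  `|partial_sum x a m| <= M * `|partial_sum x a n|.

Lemma partial_sumE x a : [series a n *: x n]_n = partial_sum x a.
Proof. by rewrite seriesEord. Qed.

Lemma partial_sumS x a n :
  partial_sum x a n.+1 = partial_sum x a n + a n *: x n.
Proof. by rewrite /partial_sum big_ord_recr. Qed.

Lemma partial_sumB x a b n :
  partial_sum x (fun i => a i - b i) n = partial_sum x a n - partial_sum x b n.
Proof.
by rewrite /partial_sum -sumrB; apply: eq_bigr => i _; rewrite scalerBl.
Qed.

Lemma partial_sumZD x a b (c : K) n :
  partial_sum x (c *: a + b) n = c *: partial_sum x a n + partial_sum x b n.
Proof.
rewrite /partial_sum scaler_sumr -big_split; apply: eq_bigr => i _ /=.
by rewrite scalerDl scalerA.
Qed.

(** Truncation gives a finite sum an expansion as an infinite series. *)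
Definition truncate (n : nat) a i : K := if (i < n)%N then a i else 0.

Lemma partial_sum_truncate x a n m :
  partial_sum x (truncate n a) m = partial_sum x a (minn m n).
Proof.
elim: m => [|m ih]; first by rewrite min0n /partial_sum !big_ord0.
rewrite partial_sumS ih /truncate; case: (ltnP m n) => mn.
  by rewrite (minn_idPl mn) partial_sumS.
by rewrite (minn_idPr (leqW mn)) scale0r addr0.
Qed.

Lemma linear_span_partial_sum x a n : linear_span x (partial_sum x a n).
Proof. by exists n, a. Qed.

Lemma cvgr_le_norm (u : nat -> V) (l v : V) (B : K) :
  u @ \oo --> l -> (\forall n \near \oo, `|v - u n| <= B) -> `|v - l| <= B.
Proof.
move=> /cvgrPdist_lt ul uB; apply/ler_addgt0Pr => e /ul ule.
near \oo => n.
rewrite -(subrKA (u n)) (le_trans (ler_normD _ _))// lerD//; first by near: n.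
by rewrite distrC ltW//; near: n.
Unshelve. all: by end_near. Qed.

Lemma closure_approx (A : set V) z (e : K) : 0 < e -> closure A z ->
  exists2 y, A y & `|z - y| < e.
Proof.
move=> e0 /(_ (ball z e) (nbhsx_ballx z e e0))[y [Ay]].
by rewrite -ball_normE => zy; exists y.
Qed.

Lemma null_partial_sum x (a : nat -> nat -> K) m :
  (forall i, null (a^~ i : nat -> (K : normedModType K))) ->
  null (fun j => partial_sum x (a j) m).
Proof.
move=> a0; elim: m => [|m ih].
  by apply: eq_null (null0 (V := V)) => j; rewrite /partial_sum big_ord0.
have am : null (fun j => a j m *: x m).
  move=> e e0; have c0 : 0 < `|x m| + 1 by rewrite ltr_wpDl.
  have [N hN] := a0 m _ (divr_gt0 e0 c0); exists N => j /hN.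
  rewrite ltr_pdivlMr// normrZ; apply: le_lt_trans.
  by rewrite ler_wpM2l// lerDl.
by apply: eq_null (nullD ih am) => j; rewrite partial_sumS.
Qed.

Section BasisInequality.
Context (x : nat -> V) (M : K) (x_neq0 : forall n, x n != 0) (M_ge1 : 1 <= M).
Hypothesis x_ineq : basis_inequality x M.

Let M_gt0 : 0 < M. Proof. exact: lt_le_trans M_ge1. Qed.

(** The m-th term is the difference of two consecutive partial sums, each of
    them bounded by the n-th one. *)
Lemma coef_le a m n : (m < n)%N ->
  `|a m| <= 2 * M / `|x m| * `|partial_sum x a n|.
Proof.
move=> mn; have xm : 0 < `|x m| by rewrite normr_gt0.
rewrite mulrAC ler_pdivlMr// -normrZ.
have -> : a m *: x m = partial_sum x a m.+1 - partial_sum x a m.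
  by rewrite partial_sumS addrAC subrr add0r.
rewrite (le_trans (ler_normB _ _))// -mulrA mulr_natl mulr2n.
by rewrite lerD// x_ineq// ltnW.
Qed.

(** The passage to the limit in the longer of the two partial sums. *)
Lemma partial_sum_le_lim a z m :
  [series a n *: x n]_n @ \oo --> z -> `|partial_sum x a m| <= M * `|z|.
Proof.
rewrite partial_sumE => /cvgrPdist_lt az; apply/ler_addgt0Pr => e e0.
have [N _ hN] := az _ (divr_gt0 e0 M_gt0).
have := hN (maxn m N) (leq_maxr _ _); rewrite ltr_pdivlMr// mulrC => he.
rewrite (le_trans (x_ineq a (leq_maxl m N)))//.
rewrite (le_trans _ (lerD (lexx _) (ltW he)))// -mulrDr ler_pM2l//.
by rewrite -{1}(subKr z (partial_sum _ _ _)) ler_normB.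
Qed.

Lemma expansion_unique a b z :
  [series a n *: x n]_n @ \oo --> z -> [series b n *: x n]_n @ \oo --> z -> a = b.
Proof.
rewrite !partial_sumE => az bz.
have ab0 : [series (a n - b n) *: x n]_n @ \oo --> (0 : V).
  rewrite partial_sumE -(subrr z).
  have -> : partial_sum x (fun n => a n - b n) = partial_sum x a - partial_sum x b.
    by apply/funext => n; rewrite partial_sumB.
  exact: cvgB.
apply/funext => n; apply/eqP; rewrite -subr_eq0 -normr_le0.
apply: le_trans (coef_le (fun i => a i - b i) (ltnSn n)) _.
have := partial_sum_le_lim n.+1 ab0; rewrite normr0 mulr0 normr_le0 => /eqP ->.
by rewrite normr0 mulr0.
Qed.
End BasisInequality.
End PartialSums.

(** * Characterization of essential basic sequences *)

Section Characterization.
Context (R : realType) (k : scalar_kind).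
Local Notation K := (scalar_field R k).
Context {V : normedModType K}.
Implicit Types (x : nat -> V) (a : nat -> K) (z : V) (Z : set V).

(** The coefficients of z are the limits of those of its approximants, which are
    Cauchy by [coef_le]; the approximation of partial sums is uniform in their
    length because M does not depend on it. *)
Lemma expansion_exists x M : (forall n, x n != 0) -> 1 <= M ->
  basis_inequality x M -> forall z, closure (linear_span x) z ->
  exists a, [series a n *: x n]_n @ \oo --> z.
Proof.
move=> x_neq0 M1 x_ineq z zx; have M0 : 0 < M by apply: lt_le_trans M1.
pose d j : K := j.+1%:R^-1.
have d0 j : 0 < d j by rewrite invr_gt0.
have dle i j : (i <= j)%N -> d j <= d i.
  by move=> ij; rewrite lef_pV2 ?posrE// ler_nat.
(* The approximant y_j is the combination of the first N j vectors with
   coefficients b j; truncating makes its later partial sums constant. *)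
have /choice[Nb hNb] j : exists Nb : nat * (nat -> K),
    (forall n, partial_sum x Nb.2 (maxn n Nb.1) = partial_sum x Nb.2 Nb.1) /\
    `|z - partial_sum x Nb.2 Nb.1| < d j.
  have [_ [N [b ->]] zb] := closure_approx (d0 j) zx.
  exists (N, truncate N b); rewrite /= partial_sum_truncate minnn; split=> // n.
  by rewrite partial_sum_truncate (minn_idPr (leq_maxr _ _)).
pose N j := (Nb j).1; pose b j := (Nb j).2.
have bN j n : (N j <= n)%N -> partial_sum x (b j) n = partial_sum x (b j) (N j).
  by move=> /maxn_idPl {1}<-; exact: (hNb j).1.
have diff_le j l n : (j <= l)%N -> (maxn (N j) (N l) <= n)%N ->
    `|partial_sum x (fun i => b j i - b l i) n| <= 2 * d j.
  move=> jl; rewrite geq_max partial_sumB => /andP[/bN -> /bN ->].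
  rewrite mulr_natl mulr2n -(subrKA z) (le_trans (ler_normD _ _))// lerD//.
    by rewrite distrC ltW//; exact: (hNb j).2.
  by rewrite (le_trans (ltW (hNb l).2))// dle.
have /choice[a ha] i : exists l : K,
    null (fun j => b j i - l : (K : normedModType K)).
  apply: scalar_complete => e e0.
  have xi : 0 < `|x i| by rewrite normr_gt0.
  have c0 : 0 < 2 * M / `|x i| * 2 by rewrite !mulr_gt0 ?invr_gt0.
  have [J hJ] := scalar_archimedean (divr_gt0 e0 c0).
  have close p q : (J <= p)%N -> (p <= q)%N -> `|b p i - b q i| < e.
    move=> Jp pq; have [n [ni nN]] : exists n, (i < n)%N /\ (maxn (N p) (N q) <= n)%N.
      by exists (maxn i.+1 (maxn (N p) (N q))); rewrite leq_maxl leq_maxr.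
    apply: le_lt_trans (coef_le x_neq0 x_ineq (fun i => b p i - b q i) ni) _.
    apply: (@le_lt_trans _ _ (2 * M / `|x i| * (2 * d J))).
      rewrite ler_pM2l ?mulr_gt0 ?invr_gt0//.
      by rewrite (le_trans (diff_le p q n pq nN))// ler_pM2l// dle.
    by rewrite mulrA mulrC -ltr_pdivlMr.
  exists J => p q Jp Jq; case: (leqP p q) => [|/ltnW] pq; first exact: close.
  by rewrite distrC; exact: close.
(* Uniform in m: pass to the limit in l in the bound for y_j - y_l. *)
have sum_le j m : `|partial_sum x (b j) m - partial_sum x a m| <= M * (2 * d j).
  apply/ler_addgt0Pr => e e0.
  have [L hL] := null_partial_sum x m ha e0.
  pose l := maxn j L; have := hL l (leq_maxr _ _); rewrite partial_sumB => hl.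
  rewrite -(subrKA (partial_sum x (b l) m)) (le_trans (ler_normD _ _))//.
  apply: lerD (ltW hl); rewrite -partial_sumB.
  pose n := maxn m (maxn (N j) (N l)).
  apply: le_trans (x_ineq _ m n (leq_maxl _ _)) _.
  by rewrite ler_pM2l//; exact: diff_le (leq_maxl _ _) (leq_maxr _ _).
exists a; rewrite partial_sumE; apply/cvgrPdist_lt => e e0.
have c0 : 0 < 1 + M * 2 by rewrite addr_gt0// mulr_gt0.
have [j hj] := scalar_archimedean (divr_gt0 e0 c0).
exists (N j) => // m /= /bN jm.
rewrite -(subrKA (partial_sum x (b j) m)) (le_lt_trans (ler_normD _ _))//.
apply: (@le_lt_trans _ _ ((1 + M * 2) * d j)); last by rewrite mulrC -ltr_pdivlMr.
by rewrite mulrDl mul1r lerD// -?mulrA// jm ltW//; exact: (hNb j).2.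
Qed.

Lemma sum_mapE x a z : [series a n *: x n]_n @ \oo --> z -> sum_map x a = z.
Proof. exact: norm_cvg_lim. Qed.

(** [coef_norm] is a supremum in an order that is only partial for complex
    scalars, hence a least upper bound only once one is known to exist. *)
Lemma coef_norm_lub x a : (exists B, forall n, `|partial_sum x a n| <= B) ->
  (forall n, `|partial_sum x a n| <= coef_norm x a) /\
  forall B, (forall n, `|partial_sum x a n| <= B) -> coef_norm x a <= B.
Proof.
move=> [B hB]; set E := [set `|\sum_(i < n.+1) a i *: x i| | n in [set: nat]].
have E0 : E !=set0 by exists `|\sum_(i < 1) a i *: x i|, 0%N.
have [s hs] : supremums E !=set0.
  apply: (@scalar_supremum _ _ _ B) => //; first by move=> _ [n _ <-].
  by move=> _ [n _ <-]; exact: hB.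
have [ub lub] : supremums E (coef_norm x a).
  rewrite /coef_norm -/E /supremum ifF; last exact/negbTE/set0P.
  exact: (@xgetI _ 0 (supremums E) s hs).
split; first case=> [|n]; last by move=> C hC; apply: lub => _ [n _ <-]; exact: hC.
- rewrite {1}/partial_sum big_ord0 normr0; apply: le_trans (normr_ge0 _) _.
  by apply: ub; exists 0%N.
- by apply: ub; exists n.
Qed.

(** For a Schauder basis, linearity and bijectivity of the sum map are uniqueness
    and existence of expansions, and its boundedness with constant 1 is the
    lower semicontinuity of the norm along partial sums. Only the boundedness of
    the inverse has content; it is stated here without the supremum. *)
Lemma essential_schauder_basisP Z x :
  essential_schauder_basis Z x <-> schauder_basis Z x /\
  exists2 C : K, 0 <= C & forall a z n, Z z -> [series a n *: x n]_n @ \oo --> z ->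
    `|partial_sum x a n| <= C * `|z|.
Proof.
have norm_le_coef a (z : V) : [series a n *: x n]_n @ \oo --> z ->
    (forall n, `|partial_sum x a n| <= coef_norm x a) -> `|z| <= coef_norm x a.
  rewrite partial_sumE => az h; rewrite -normrN -sub0r.
  by apply: cvgr_le_norm az _; near=> n; rewrite sub0r normrN.
have bounded a (z : V) : [series a n *: x n]_n @ \oo --> z ->
    exists B, forall n, `|partial_sum x a n| <= B.
  rewrite partial_sumE => az; have /cvg_seq_bounded/pinfty_ex_gt0[B _ hB] : cvgn (partial_sum x a).
    by apply/cvg_ex; exists z.
  by exists B => n; exact: hB.
split=> [[basis [_ _ _ [C C0 hC]]]|[basis [C C0 hC]]]; split=> //.
  exists C => // a z n Zz az; have aZ : coef_space Z x a by exists z.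
  by rewrite -(sum_mapE az) (le_trans _ (hC a aZ))// (coef_norm_lub (bounded a z az)).1.
split.
- move=> c a b [y Zy ay] [z Zz bz]; rewrite (sum_mapE ay) (sum_mapE bz).
  apply: sum_mapE; move: ay bz; rewrite !partial_sumE => ay bz.
  have -> : partial_sum x (c *: a + b) = (c *: partial_sum x a + partial_sum x b).
    by apply/funext => n; rewrite partial_sumZD.
  by apply: cvgD => //; exact: cvgZr.
- split=> [a [z Zz az]|a b|z Zz]; first by rewrite (sum_mapE az).
    rewrite !inE => -[y Zy ay] [z Zz bz]; rewrite (sum_mapE ay) (sum_mapE bz) => yz.
    subst z; have [c [_ uniq_c]] := basis.2 y Zy.
    by rewrite -(uniq_c a ay) -(uniq_c b bz).
  have [a [az _]] := basis.2 z Zz; exists a; last exact: sum_mapE.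
  by exists z.
- exists 1 => // a [z Zz az]; rewrite mul1r (sum_mapE az).
  exact: norm_le_coef az (coef_norm_lub (bounded a z az)).1.
- exists C => // a [z Zz az]; rewrite (sum_mapE az).
  by apply: (coef_norm_lub (bounded a z az)).2 => n; exact: hC.
Unshelve. all: by end_near. Qed.

(** The forward direction feeds a truncated sequence, whose partial sums
    eventually equal a given combination, to the bound of
    [essential_schauder_basisP]. The constant is 1 + C because C may be less
    than 1. *)
Lemma essential_basic_sequenceP x : (forall n, x n != 0) ->
  essential_basic_sequence x <-> exists2 M : K, 1 <= M & basis_inequality x M.
Proof.
move=> x_neq0; split=> [/essential_schauder_basisP[_ [C C0 hC]]|[M M1 x_ineq]].
  exists (1 + C); first by rewrite lerDl.
  move=> a m n mn.
  have cvg_n : [series truncate n a i *: x i]_i @ \oo --> partial_sum x a n.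
    rewrite partial_sumE; apply/cvgrPdist_lt => e e0; exists n => // l /= nl.
    by rewrite partial_sum_truncate (minn_idPr nl) subrr normr0.
  have /hC/(_ cvg_n) := subset_closure (linear_span_partial_sum x a n).
  move=> /(_ m); rewrite partial_sum_truncate (minn_idPl mn) => h.
  by rewrite (le_trans h)// ler_wpM2r// lerDr.
apply/essential_schauder_basisP; split.
  split=> [n|z zx].
    apply: subset_closure; exists n.+1, (fun i => (i == n)%:R).
    rewrite big_ord_recr /= eqxx scale1r big1 ?add0r// => i _.
    by rewrite ltn_eqF// scale0r.
  have [a az] := expansion_exists x_neq0 M1 x_ineq zx.
  by exists a; split=> // b bz; exact: expansion_unique x_neq0 M1 x_ineq _ _ _ az bz.
exists M => [|a z n _ az]; first exact: le_trans M1.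
exact: partial_sum_le_lim M1 x_ineq _ _ _ az.
Qed.
End Characterization.

Lemma basis_inequalityS (K : numFieldType) (V : normedModType K) (x : nat -> V)
    (M : K) : basis_inequality x M <-> forall (a : nat -> K) (m n : nat), (m <= n)%N ->
      `|\sum_(i < m.+1) a i *: x i| <= M * `|\sum_(i < n.+1) a i *: x i|.
Proof.
split=> [h a m n mn|h a m n]; first exact: h.
case: m => [|m].
  rewrite {1}/partial_sum big_ord0 normr0 => _; case: n => [|n].
    by rewrite /partial_sum big_ord0 normr0 mulr0.
  exact: le_trans (h a n n (leqnn n)).
by case: n => // n; exact: (h a m n).
Qed.

(** * Transfer to the completion *)

Lemma basis_inequality_isometry (K : numFieldType) (V W : normedModType K)
    (f : {linear V -> W}) (x : nat -> V) (M : K) : (forall v, `|f v| = `|v|) ->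
  basis_inequality (f \o x) M <-> basis_inequality x M.
Proof.
move=> fE; have sumE a n : `|partial_sum (f \o x) a n| = `|partial_sum x a n|.
  rewrite -fE /partial_sum linear_sum; congr `|_|.
  by apply: eq_bigr => i _; rewrite linearZ.
by split=> h a m n /(h a); rewrite !sumE.
Qed.

Theorem theorem1 (R : realType) (k : scalar_kind)
    (X : normedModType (scalar_field R k)) (x : nat -> X)
    (Xh : completeNormedModType (scalar_field R k)) (iota : {linear X -> Xh})
    (Xh_completion : is_completion iota)
    (x_neq0 : forall n, x n != 0) :
  [<-> essential_schauder_basis (closure (linear_span (iota \o x))) (iota \o x);
       essential_basic_sequence x;
       exists2 M : scalar_field R k, 1 <= M &
         forall (a : nat -> scalar_field R k) (m n : nat), (m <= n)%N ->
           `|\sum_(i < m.+1) a i *: x i| <= M * `|\sum_(i < n.+1) a i *: x i| ].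
Proof.
have [iota_norm _] := Xh_completion.
have ix_neq0 n : (iota \o x) n != 0 by rewrite -normr_gt0 /= iota_norm normr_gt0.
split; [|split].
- move=> /(essential_basic_sequenceP ix_neq0)[M M1 ineq].
  apply/(essential_basic_sequenceP x_neq0); exists M => //.
  exact/(basis_inequality_isometry _ _ iota_norm).
- move=> /(essential_basic_sequenceP x_neq0)[M M1 /basis_inequalityS ineq].
  by exists M.
- move=> [M M1 /basis_inequalityS ineq].
  apply/(essential_basic_sequenceP ix_neq0); exists M => //.
  exact/(basis_inequality_isometry _ _ iota_norm).
Qed.
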